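(* Consider the two-stage stratified sampling algorithm described in the context (without sample reuse). Let $\delta>0$ be small, let $p_*=\frac{2\ln(1/\delta)+2\sqrt{\ln(1/\delta)}+2}{N_1}$, and let $\mathcal{E}$ be the Stage 1 event, of arbitrarily small failure probability governed by $\delta$, on which all of the following hold: (i) for all $k$: $\sqrt{p_k}\sqrt{1-O\big(\sqrt{\tfrac{\ln(1/\delta)}{p_kN_1}}\big)}\le\sqrt{\hat p_k}\le\sqrt{p_k}\sqrt{1+O\big(\sqrt{\tfrac{\ln(1/\delta)}{p_kN_1}}\big)}$; (ii) for all $k$: $w_k-O\big(\tfrac{\ln(1/\delta)\sqrt{p_k}}{\sqrt{N_1}}\big)\le\hat w_k\le w_k+O\big(\tfrac{\ln(1/\delta)\sqrt{p_k}}{\sqrt{N_1}}\big)$; (iii) for all $k$: $B_k^{(1)}\ge p_kN_1-\sqrt{2\ln(1/\delta)p_kN_1}$; (iv) for all $k$ with $B_k^{(1)}\ge 2$: $\sigma_k\sqrt{1-O\big(\sqrt{\tfrac{\ln(1/\delta)}{p_kN_1}}\big)}\le\hat\sigma_k\le\sigma_k\sqrt{1+O\big(\sqrt{\tfrac{\ln(1/\delta)}{p_kN_1}}\big)}$; (v) for all $k$ with $B_k^{(1)}<2$: $\sqrt{\hat p_k}\hat\sigma_k\le\sqrt{p_k}\sigma_k+O(N_1^{-1/2})$; (vi) for all $k$ with $p_k>p_*$: $\hat T_k\ge T_k\big(1-O\big(\sqrt{\tfrac{\ln(1/\delta)}{p_kN_1}}\big)\big)$. If $N_2=\omega(N_1^{3/4})$,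 then on $\mathcal{E}$, with the expectation taken over the randomness of Stage 2 (conditionally on Stage 1), $$\mathbb{E}\big[(\hat\mu_{\text{all}}-\mu_{\text{all}})^2\big]\le O\big(N_1^{-1}\big)+O\big(N_2^{-1}\big)+O\big(N_1^{1/2}N_2^{-3/2}\big).$$
   Context: Setting. A dataset is split into $K$ equal-sized disjoint strata $S_1,\dots,S_K$. A record drawn uniformly from $S_k$ satisfies a predicate with probability $p_k$; draws are i.i.d. The statistic values of predicate-matching records drawn from $S_k$ are i.i.d. subgaussian random variables $X_{k,i}$ with mean $\mu_k$ and variance $\sigma_k^2$. Assumptions: $\mathbb{E}|X_{k,i}|\le C_k^{(\mu)}$, $\mathrm{Var}[X_{k,i}]\le C_k^{(\sigma^2)}$, and $p_{\text{all}}=\sum_{k=1}^K p_k\ge C^{(p_{\text{all}})}$, where $C_k^{(\mu)},C_k^{(\sigma^2)},C^{(p_{\text{all}})}$ are positive constants. Put $w_k=p_k/p_{\text{all}}$, $\mu_{\text{all}}=\sum_k w_k\mu_k$, and $T_k=\sqrt{p_k}\sigma_k/\sum_{i=1}^K\sqrt{p_i}\sigma_i$. Algorithm (no sample reuse). Stage 1: draw $N_1$ records from each stratum. Let $B_k^{(1)}\sim\mathrm{Binomial}(N_1,p_k)$ be the number of matching records in $S_k$; $\hat p_k=B_k^{(1)}/N_1$; $\hat\sigma_k^2$ is the sample variance (normalized by $B_k^{(1)}-1$) of the matching values if $B_k^{(1)}>1$, else $0$; $\hat w_k=\hat p_k/\sum_i\hat p_i$; $\hat T_k=\sqrt{\hat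 p_k}\hat\sigma_k/\sum_{i=1}^K\sqrt{\hat p_i}\hat\sigma_i$. Stage 2: draw $\lceil N_2\hat T_k\rceil$ fresh records from each $S_k$. Let $B_k^{(2)}$ be the number of these that match; given Stage 1, $B_k^{(2)}\sim\mathrm{Binomial}(\lceil N_2\hat T_k\rceil,p_k)$; $\hat\mu_k$ is the mean of the matching Stage 2 values if $B_k^{(2)}>0$, else $0$. Output $\hat\mu_{\text{all}}=\sum_k\hat w_k\hat\mu_k$. The total budget is $N=KN_1+N_2$ (up to rounding by at most $K$). Big-O convention: $T(\dots)=O(f(\dots))$ iff there exist $C,N_0$ such that for all $N\ge N_0$, $0\le T(\dots)\le C\,f(\dots)$; $C$ and $N_0$ are independent of $N_1,N_2,p_k,\delta$. Inside an expression, $O(f)$ stands for some quantity that is $O(f)$. $N_2=\omega(N_1^{3/4})$ means $N_2/N_1^{3/4}\to\infty$.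
   Formalization: The constants and the threshold N_0 in the final bound may depend on δ (δ is fixed first; independence from δ fails), and σ_k > 0 is assumed for every stratum (otherwise a stratum with σ_k = 0, μ_k ≠ 0 gets no Stage 2 draws and the bound fails). *)

(* Defs.v *)
(* MathComp / MathComp-Analysis *)
From HB Require Import structures.
From mathcomp Require Import all_boot all_order all_algebra.
From mathcomp Require Import all_classical all_reals all_analysis.
Import Order.TTheory GRing.Theory Num.Theory.
Import numFieldNormedType.Exports.

Set Implicit Arguments.
Unset Strict Implicit.
Unset Printing Implicit Defensive.

Local Open Scope classical_set_scope.
Local Open Scope ring_scope.

Definition law_mean (R : realType) (D : probability R R) : R := fine 'E_D[id].

Definition law_variance (R : realType) (D : probability R R) : R :=
  fine 'V_D[id].

Definition law_stddev (R : realType) (D : probability R R) : R :=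
  Num.sqrt (law_variance D).

Definition subgaussian (R : realType) (D : probability R R) : Prop :=
  exists s : R, forall t : R,
    (mmt_gen_fun D (fun x => (x - law_mean D)%R) t
      <= (expR (s ^+ 2 * t ^+ 2 / 2))%:E)%E.

Definition mutually_independent d (Omega : measurableType d) (R : realType)
    (P : probability Omega R) d' (T : measurableType d') (I : eqType)
    (Z : I -> Omega -> T) : Prop :=
  forall (s : seq I) (A : I -> set T), uniq s -> (forall i, measurable (A i)) ->
    P (\big[setI/setT]_(i <- s) (Z i @^-1` A i)) =
    (\prod_(i <- s) P (Z i @^-1` A i))%E.

(* [Z k j] is the j-th record drawn from stratum k in one stage of the
   algorithm: its first component tells whether the record matches the
   predicate, and its second component is its statistic value, which is
   unconstrained and never used when the record does not match.  Taking A to be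
   the full set, a record matches with probability [p k]; conditionally on
   matching, its value has law [D k].  By independence of the draws, the
   matching values of stratum k are then i.i.d. with law [D k], whatever the
   matching pattern.  A stage only looks at finitely many of the draws. *)
Definition stratified_draws d (Omega : measurableType d) (R : realType)
    (P : probability Omega R) (K : nat) (p : 'I_K -> R)
    (D : 'I_K -> probability R R)
    (Z : 'I_K -> nat -> {RV P >-> (bool * R)%type}) : Prop :=
  (forall k j (A : set R), measurable A ->
     P (Z k j @^-1` ([set true] `*` A)) = ((p k)%:E * D k A)%E) /\
  mutually_independent P (fun kj : 'I_K * nat => (Z kj.1 kj.2 : Omega -> _)).

Definition matching_values (R : realType) (z : nat -> bool * R) (n : nat) :
    seq R :=
  [seq (z j).2 | j <- iota 0 n & (z j).1].

Definition sample_mean (R : realType) (x : seq R) : R :=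
  if (0 < size x)%N then (\sum_(y <- x) y) / (size x)%:R else 0.

Definition sample_variance (R : realType) (x : seq R) : R :=
  if (1 < size x)%N
  then (\sum_(y <- x) (y - sample_mean x) ^+ 2) / (size x - 1)%N%:R else 0.

(* w_k, and its plug-in version when applied to the estimates of p *)
Definition weight (R : realType) (K : nat) (p : 'I_K -> R) (k : 'I_K) : R :=
  p k / \sum_(i < K) p i.

(* T_k, and its plug-in version when applied to the estimates of p and sigma;
   if all the terms of the denominator vanish then the allocation is 0 *)
Definition allocation (R : realType) (K : nat) (p sigma : 'I_K -> R)
    (k : 'I_K) : R :=
  Num.sqrt (p k) * sigma k / \sum_(i < K) (Num.sqrt (p i) * sigma i).

(* In the following definitions, [x k] is the sequence of the matching values
   of the Stage 1 sample of stratum k; thus B_k^(1) is [size (x k)]. *)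
Definition p_hat (R : realType) (K N1 : nat) (x : 'I_K -> seq R) (k : 'I_K) :
    R :=
  (size (x k))%:R / N1%:R.

Definition sigma_hat (R : realType) (K : nat) (x : 'I_K -> seq R) (k : 'I_K) :
    R :=
  Num.sqrt (sample_variance (x k)).

Definition w_hat (R : realType) (K N1 : nat) (x : 'I_K -> seq R) : 'I_K -> R :=
  weight (p_hat N1 x).

Definition T_hat (R : realType) (K N1 : nat) (x : 'I_K -> seq R) : 'I_K -> R :=
  allocation (p_hat N1 x) (sigma_hat x).

Definition stage2_size (R : realType) (K N1 N2 : nat) (x : 'I_K -> seq R)
    (k : 'I_K) : nat :=
  `|Num.ceil (N2%:R * T_hat N1 x k)|%N.

(* z k j is the j-th fresh record drawn from stratum k in Stage 2 *)
Definition mu_hat_all (R : realType) (K N1 N2 : nat) (x : 'I_K -> seq R)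
    (z : 'I_K -> nat -> bool * R) : R :=
  \sum_(k < K) w_hat N1 x k *
    sample_mean (matching_values (z k) (stage2_size N1 N2 x k)).

Definition mu_all (R : realType) (K : nat) (p : 'I_K -> R)
    (D : 'I_K -> probability R R) : R :=
  \sum_(k < K) weight p k * law_mean (D k).

Definition p_star (R : realType) (delta : R) (N1 : nat) : R :=
  (2 * ln delta^-1 + 2 * Num.sqrt (ln delta^-1) + 2) / N1%:R.

(* The conditions defining the Stage 1 event.  Each quantity O(f) is replaced by
   its upper bound c * f; the conditions get weaker as c grows, so a common
   constant c covers arbitrary constants in the individual O's.  Num.sqrt is 0
   on negative numbers, hence the lower bounds in [ev_p_hat] and [ev_sigma_hat]
   degenerate to 0 when the radicand is negative.  A stratum with [p k = 0] is
   allowed (the quotient by [p k] is then 0, and [ev_p_hat] states that it has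
   no matching record). *)
Record stage1_event (R : realType) (K : nat) (c delta : R) (N1 : nat)
    (p sigma : 'I_K -> R) (x : 'I_K -> seq R) : Prop := {
  ev_p_hat : forall k,
    let e := c * Num.sqrt (ln delta^-1 / (p k * N1%:R)) in
    Num.sqrt (p k) * Num.sqrt (1 - e) <= Num.sqrt (p_hat N1 x k)
      <= Num.sqrt (p k) * Num.sqrt (1 + e);
  ev_w_hat : forall k,
    let e := c * (ln delta^-1 * Num.sqrt (p k) / Num.sqrt N1%:R) in
    weight p k - e <= w_hat N1 x k <= weight p k + e;
  ev_matches : forall k,
    p k * N1%:R - Num.sqrt (2 * ln delta^-1 * p k * N1%:R) <= (size (x k))%:R;
  ev_sigma_hat : forall k, (2 <= size (x k))%N ->
    let e := c * Num.sqrt (ln delta^-1 / (p k * N1%:R)) in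
    sigma k * Num.sqrt (1 - e) <= sigma_hat x k <= sigma k * Num.sqrt (1 + e);
  ev_few_matches : forall k, (size (x k) < 2)%N ->
    Num.sqrt (p_hat N1 x k) * sigma_hat x k
      <= Num.sqrt (p k) * sigma k + c * (Num.sqrt N1%:R)^-1;
  ev_T_hat : forall k, p_star delta N1 < p k ->
    allocation p sigma k * (1 - c * Num.sqrt (ln delta^-1 / (p k * N1%:R)))
      <= T_hat N1 x k }.

(* Main.v *)
(* The error splits as
     sum_k w^_k (mu^_k - mu_k) + sum_k (w^_k - w_k) mu_k,
   and, K being fixed, its square is at most 2K times the sum of the squares of
   the terms.  By (ii) the second kind of term contributes O(1/N1).  For the
   first, let n be the Stage 2 sample size of stratum k: given the set of
   matching draws, the sample mean is unbiased, with variance sigma_k^2 / B when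
   B > 0 of them match, so that its mean squared error e satisfies e <= C and
   n p_k e <= C, by E[1/(B+1)] <= 1/((n+1) p_k).  If p_k = O(1/N1), then
   w^_k = O(1/N1) by (ii), and w^_k^2 e = O(1/N1).  Otherwise w^_k = O(p_k), and
   (vi) gives n >= N2 T_k / 2 >= const * N2 sqrt(p_k), so that
   w^_k^2 e <= const * p_k^2 / (n p_k) <= const * sqrt(p_k) / N2 = O(1/N2). *)
Require Import Defs.
From mathcomp Require Import all_boot all_order all_algebra.
From mathcomp Require Import all_classical all_reals all_analysis.
From mathcomp Require Import measurable_realfun ring lra.
Import Order.TTheory GRing.Theory Num.Theory.
Import numFieldNormedType.Exports.

Local Open Scope classical_set_scope.
Local Open Scope ring_scope.

(** * Integrals of products of independent variables *)

Section weighted_integral.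
Local Open Scope ereal_scope.
Import HBNNSimple.

(** The hypothesis says that the measure with density [H], carried along [X], is [c * nu] on sets;
    simple functions and monotone convergence extend this to nonnegative [f]. The weight [H] will be
    either the indicator of a match or the rest of a product of independent factors. *)
Lemma ge0_integral_weight d d' (Omega : measurableType d)
    (T : measurableType d') (R : realType) (mu : {measure set Omega -> \bar R})
    (nu : {measure set T -> \bar R}) (X : Omega -> T) (H : Omega -> R) (c : R)
    (f : T -> \bar R) :
  measurable_fun setT X -> measurable_fun setT H -> (forall w, (0 <= H w)%R) ->
  (0 <= c)%R ->
  (forall A, measurable A ->
     \int[mu]_w (\1_A (X w) * H w)%:E = c%:E * nu A) ->
  measurable_fun setT f -> (forall x, 0 <= f x) ->
  \int[mu]_w (f (X w) * (H w)%:E) = c%:E * \int[nu]_x f x.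
Proof.
move=> mX mH H0 c0 muH mf f0.
pose g := nnsfun_approx measurableT mf.
have gf x : (g n x)%:E @[n --> \oo] --> f x.
  by apply: cvg_nnsfun_approx.
have ndg x : {homo (fun n => (g n x)%:E) : m n / (m <= n)%N >-> m <= n}.
  by move=> m n mn; rewrite lee_fin; exact/lefP/nd_nnsfun_approx.
have cvl : \int[mu]_w ((g n (X w))%:E * (H w)%:E) @[n --> \oo] -->
    \int[mu]_w (f (X w) * (H w)%:E).
  have -> : \int[mu]_w (f (X w) * (H w)%:E) =
      \int[mu]_w limn (fun n => (g n (X w))%:E * (H w)%:E).
    apply: eq_integral => w _; apply/esym/cvg_lim => //.
    exact: (cvgeZr _ (gf (X w))).
  apply: cvg_monotone_convergence => //.
  - move=> n; apply: emeasurable_funM; last exact/measurable_EFinP.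
    by apply/measurable_EFinP; apply: measurableT_comp.
  - by move=> n w _; rewrite mule_ge0// lee_fin.
  - move=> w _ m n mn; rewrite lee_wpmul2r ?lee_fin//.
    exact/lefP/nd_nnsfun_approx.
have cvr : c%:E * \int[nu]_x (g n x)%:E @[n --> \oo] --> c%:E * \int[nu]_x f x.
  apply: cvgeZl => //.
  have -> : \int[nu]_x f x = \int[nu]_x limn (fun n => (g n x)%:E).
    by apply: eq_integral => x _; apply/esym/cvg_lim => //; exact: gf.
  apply: cvg_monotone_convergence => //.
  - by move=> n; exact/measurable_EFinP.
  - by move=> n x _; rewrite lee_fin.
(* On a simple function both sides are finite sums over its values [r]; a negative [r] has an empty
   level set, so all the terms are nonnegative. *)
have step n : \int[mu]_w ((g n (X w))%:E * (H w)%:E) =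
    c%:E * \int[nu]_x (g n x)%:E.
  have mA r : measurable (g n @^-1` [set r]) by [].
  have mI r :
      measurable_fun setT (fun w => \1_(g n @^-1` [set r]) (X w) * H w)%R.
    apply: measurable_funM => //; apply: (measurableT_comp _ mX).
    exact: measurable_indic.
  have I0 r w : (0 <= \1_(g n @^-1` [set r]) (X w) * H w)%R by rewrite mulr_ge0.
  transitivity (\sum_(r \in range (g n)) \int[mu]_w
      (r%:E * (\1_(g n @^-1` [set r]) (X w) * H w)%:E)).
    rewrite -ge0_integral_fsum//.
    - apply: eq_integral => w _; rewrite -EFinM fimfunE.
      rewrite fsbig_finite// [RHS]fsbig_finite//= mulr_suml -sumEFin.
      by apply: eq_bigr => r _; rewrite -EFinM mulrA.
    - by move=> r; apply: measurable_funeM; exact/measurable_EFinP.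
    - move=> r w _; rewrite -EFinM lee_fin mulrA mulr_ge0//.
      exact: nnfun_muleindic_ge0.
  rewrite integralT_nnsfun sintegralE fsbig_finite// [in RHS]fsbig_finite//=.
  rewrite ge0_sume_distrr; last first.
    move=> r; case: (ltP r 0%R) => [r0|r0]; last by rewrite mule_ge0.
    by rewrite preimage_nnfun0// measure0 mule0.
  apply: eq_bigr => r _; case: (ltP r 0%R) => [r0|r0].
    rewrite preimage_nnfun0// measure0 !mule0 integral0_eq// => w _.
    by rewrite indic0/= mul0r mule0.
  rewrite ge0_integralZl_EFin//; last 2 first.
  - by move=> w _; rewrite lee_fin.
  - exact/measurable_EFinP.
  by rewrite muH// !muleA (muleC r%:E).
rewrite (funext step) in cvl.
exact: cvg_unique cvl cvr.
Qed.

End weighted_integral.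

(** Passage from the independence of events to that of functions; nonnegativity avoids any
    discussion of integrability. *)
Lemma integral_prod_independent d (Omega : measurableType d) (R : realType)
    (P : probability Omega R) d' (T : measurableType d') (I : eqType)
    (Z : I -> {RV P >-> T}) (f : I -> T -> R) (r : I -> R) (s : seq I) :
  mutually_independent P (fun i => Z i : Omega -> T) -> uniq s ->
  (forall i, measurable_fun setT (f i)) -> (forall i x, 0 <= f i x) ->
  (forall i, (\int[P]_w (f i (Z i w))%:E = (r i)%:E)%E) ->
  (\int[P]_w (\prod_(i <- s) f i (Z i w))%:E = (\prod_(i <- s) r i)%:E)%E.
Proof.
move=> indep us mf f0 fr.
have r0 i : 0 <= r i.
  by rewrite -lee_fin -fr; apply: integral_ge0 => w _; rewrite lee_fin.
pose PA (A : I -> set T) i := fine (P (Z i @^-1` A i)).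
(* The indicators are replaced by the functions [f i] one at a time. *)
suff gen t (A : I -> set T) : uniq (s ++ t) -> (forall i, measurable (A i)) ->
    (\int[P]_w ((\prod_(i <- s) f i (Z i w)) *
       \prod_(i <- t) \1_(A i) (Z i w))%:E =
     ((\prod_(i <- s) r i) * \prod_(i <- t) PA A i)%:E)%E.
  have := gen [::] (fun=> set0); rewrite cats0 us big_nil mulr1 => <- //.
  by apply: eq_integral => w _; rewrite big_nil mulr1.
elim: s t A {us} => [|i s IH] t A /= us mA.
  under eq_integral do rewrite big_nil mul1r.
  rewrite big_nil mul1r.
  have mE : measurable (\big[setI/setT]_(i <- t) (Z i @^-1` A i)).
    by apply: bigsetI_measurable => i _; exact: measurable_funPTI.
  transitivity
      (\int[P]_w (\1_(\big[setI/setT]_(i <- t) (Z i @^-1` A i)) w)%:E)%E.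
    apply: eq_integral => w _; congr EFin.
    elim: (t) => [|j l IHl]; first by rewrite !big_nil indicT.
    by rewrite !big_cons indicI/= IHl.
  rewrite integral_indic// setIT.
  transitivity (\prod_(i <- t) P (Z i @^-1` A i))%E; first exact: indep.
  rewrite -prodEFin.
  apply: eq_bigr => j _; rewrite fineK ?fin_num_measure//.
  exact: measurable_funPTI.
have /andP[ist us'] := us.
(* The factor at [i] is integrated against the weight [H] made of all the other factors. *)
pose H w := (\prod_(j <- s) f j (Z j w)) * \prod_(j <- t) \1_(A j) (Z j w).
have mH : measurable_fun setT H.
  apply: measurable_funM; apply: measurable_prod => j _.
    exact: measurableT_comp.
  by apply: measurableT_comp => //; exact: measurable_indic.
have H0 w : 0 <= H w by rewrite mulr_ge0// prodr_ge0.
have PA0 j : 0 <= PA A j by exact: fine_ge0.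
transitivity (\int[P]_w ((f i (Z i w))%:E * (H w)%:E))%E.
  by apply: eq_integral => w _; rewrite big_cons -EFinM mulrA.
rewrite (@ge0_integral_weight _ _ _ _ _ P (distribution P (Z i)) (Z i) H
  ((\prod_(j <- s) r j) * \prod_(j <- t) PA A j) (EFin \o f i))//; last first.
- by move=> x; rewrite lee_fin.
- exact/measurable_EFinP.
- move=> B mB.
  (* The required identity on a set [B] is the induction hypothesis with [i] moved to the list of
     indicators and given the set [B]. *)
  pose A' j := if j == i then B else A j.
  have mA' j : measurable (A' j) by rewrite /A'; case: ifP.
  have neq j : j \in s ++ t -> (j == i) = false.
    by move=> jst; apply/negP => /eqP ji; rewrite -ji jst in ist.
  have us2 : uniq (s ++ i :: t).
    by rewrite uniq_catC/= mem_cat orbC -mem_cat ist/= uniq_catC.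
  have := IH (i :: t) A' us2 mA'.
  rewrite big_cons => IHi.
  have A'i : A' i = B by rewrite /A' eqxx.
  transitivity (\int[P]_w ((\prod_(i0 <- s) f i0 (Z i0 w)) *
      (\prod_(i0 <- (i :: t)) \1_(A' i0) (Z i0 w)))%:E)%E.
    apply: eq_integral => w _; rewrite /H big_cons A'i mulrCA.
    congr (_ * (_ * _))%:E.
    rewrite !big_seq; apply: eq_bigr => j jt; rewrite /A' neq//.
    by rewrite mem_cat jt orbT.
  have DB : (distribution P (Z i) B = (fine (P (Z i @^-1` B)))%:E)%E.
    by rewrite fineK// fin_num_measure//; exact: measurable_funPTI.
  rewrite IHi {1}/PA A'i [RHS]muleC.
  transitivity ((fine (P (Z i @^-1` B)))%:E *
      ((\prod_(j <- s) r j) * \prod_(j <- t) PA A j)%:E)%E; last first.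
    by congr (_ * _)%E; exact/esym/DB.
  rewrite -EFinM; congr EFin; rewrite mulrCA; congr (_ * (_ * _)).
  rewrite !big_seq; apply: eq_bigr => j jt; rewrite /PA /A' neq//.
  by rewrite mem_cat jt orbT.
- by rewrite mulr_ge0// prodr_ge0.
rewrite ge0_integral_distribution//=; last first.
- by move=> x; rewrite lee_fin.
- exact/measurable_EFinP.
by rewrite fr -EFinM big_cons mulrC mulrA.
Qed.

Lemma ge0_integral_sum_EFin d (T : measurableType d) (R : realType)
    (mu : {measure set T -> \bar R}) (I : finType) (Q : pred I)
    (f : I -> T -> R) (r : I -> R) :
  (forall i, measurable_fun setT (f i)) -> (forall i x, 0 <= f i x) ->
  (forall i, Q i -> (\int[mu]_x (f i x)%:E = (r i)%:E)%E) ->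
  (\int[mu]_x (\sum_(i | Q i) f i x)%:E = (\sum_(i | Q i) r i)%:E)%E.
Proof.
move=> mf f0 fr.
transitivity (\int[mu]_x (\sum_(i <- enum Q) (f i x)%:E))%E.
  by apply: eq_integral => x _; rewrite sumEFin big_enum.
rewrite ge0_integral_sum//; last 2 first.
- by move=> i; exact/measurable_EFinP.
- by move=> i x _; rewrite lee_fin.
by rewrite big_enum -sumEFin; apply: eq_bigr => i; exact: fr.
Qed.

(** * Mean squared error of the sample mean in one stratum *)

Section one_stratum.
Context d (Omega : measurableType d) (R : realType) (P : probability Omega R).
Variables (p : R) (D : probability R R) (Z : nat -> {RV P >-> (bool * R)%type}).
Hypothesis p01 : 0 <= p <= 1.
Hypothesis lawZ : forall j (A : set R), measurable A ->
  P (Z j @^-1` ([set true] `*` A)) = (p%:E * D A)%E.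
Hypothesis indepZ : mutually_independent P (fun j => Z j : Omega -> _).

Lemma measurable_match j : measurable_fun setT (fun w => (Z j w).1).
Proof. exact: measurableT_comp. Qed.

Lemma measurable_value j : measurable_fun setT (fun w => (Z j w).2).
Proof. exact: measurableT_comp. Qed.

(** The weight is the indicator of a match: by [lawZ], the value of a draw, restricted to matching
    draws, has law [p] times [D]. *)
Lemma integral_match j (h : R -> R) :
  measurable_fun setT h -> (forall x, 0 <= h x) ->
  (\int[P]_w (if (Z j w).1 then h (Z j w).2 else 0)%:E =
   p%:E * \int[D]_x (h x)%:E)%E.
Proof.
move=> mh h0; have /andP[p0 p1] := p01.
rewrite -(@ge0_integral_weight _ _ _ _ _ P D (fun w => (Z j w).2)
  (fun w => if (Z j w).1 then 1 else 0) p (EFin \o h))//.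
- by apply: eq_integral => w _; case: ifP => _; rewrite ?mule1 ?mule0.
- exact: measurable_value.
- by apply: measurable_fun_ifT => //; exact: measurable_match.
- by move=> w; case: ifP.
- move=> A mA; rewrite -(lawZ j)//.
  have mE : measurable (Z j @^-1` ([set true] `*` A)).
    by apply: measurable_funPTI; exact: measurableX.
  rewrite -[in RHS](setIT (Z j @^-1` _)) -integral_indic//.
  apply: eq_integral => w _; congr EFin; rewrite !indicE.
  case: ifP => Zw; rewrite ?mulr1 ?mulr0; last first.
    by rewrite memNset//= => -[]; rewrite Zw.
  congr (nat_of_bool _)%:R; apply/idP/idP; rewrite !inE.
  - by move=> ?; split.
  - by case.
- exact/measurable_EFinP.
Qed.

Lemma integral_draw j (h : R -> R) (a r : R) :
  measurable_fun setT h -> (forall x, 0 <= h x) -> 0 <= a ->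
  (\int[D]_x (h x)%:E = r%:E)%E ->
  (\int[P]_w (if (Z j w).1 then h (Z j w).2 else a)%:E =
   (p * r + (1 - p) * a)%:E)%E.
Proof.
move=> mh h0 a0 hr; have mZ := measurable_match j.
have m1 : measurable_fun setT
    (fun w => (if (Z j w).1 then h (Z j w).2 else 0)%:E).
  apply/measurable_EFinP; apply: measurable_fun_ifT => //.
  by apply: measurableT_comp => //; exact: measurable_value.
have m2 : measurable_fun setT (fun w => (if (Z j w).1 then 0 else a)%:E).
  by apply/measurable_EFinP; exact: measurable_fun_ifT.
have m3 : measurable_fun setT (fun w => (if (Z j w).1 then a else 0)%:E).
  by apply/measurable_EFinP; exact: measurable_fun_ifT.
transitivity (\int[P]_w ((if (Z j w).1 then h (Z j w).2 else 0)%:E +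
    (if (Z j w).1 then 0 else a)%:E))%E.
  by apply: eq_integral => w _; case: ifP; rewrite ?adde0 ?add0e.
rewrite ge0_integralD//; last 2 first.
- by move=> w _; rewrite lee_fin; case: ifP.
- by move=> w _; rewrite lee_fin; case: ifP.
rewrite integral_match// hr -EFinM EFinD; congr (_ + _)%E.
(* The probability of a mismatch is obtained by subtraction: the matching and nonmatching pieces of
   the constant [a] add up to [a], and the first one has integral [p * a]. *)
have ma := @integral_match j (fun=> a) (measurable_cst a) (fun=> a0).
rewrite integral_cst//= probability_setT mule1 -EFinM in ma.
have : (\int[P]_w ((if (Z j w).1 then a else 0)%:E +
    (if (Z j w).1 then 0 else a)%:E))%E = a%:E.
  rewrite -[RHS]mule1 -[in RHS](probability_setT P) -integral_cst//.
  by apply: eq_integral => w _; case: ifP; rewrite ?adde0 ?add0e.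
rewrite ge0_integralD//; last 2 first.
- by move=> w _; rewrite lee_fin; case: ifP.
- by move=> w _; rewrite lee_fin; case: ifP.
rewrite ma; case: (\int[P]_w _)%E => [x| |]//= [xa].
by congr EFin; rewrite mulrBl mul1r -{1}xa addrAC subrr add0r.
Qed.

(** * Joint law of the matching pattern and of the matching values *)

Definition matched (n : nat) (w : Omega) : {set 'I_n} :=
  [set j : 'I_n | (Z j w).1].

Definition pattern_prob (n : nat) (J : {set 'I_n}) : R :=
  p ^+ #|J| * (1 - p) ^+ (n - #|J|).

Lemma pattern_prob_ge0 n (J : {set 'I_n}) : 0 <= pattern_prob n J.
Proof.
by have /andP[p0 p1] := p01; rewrite mulr_ge0// exprn_ge0// subr_ge0.
Qed.

Lemma prod_pattern_prob n (J : {set 'I_n}) (r : 'I_n -> R) :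
  \prod_(j < n) (if j \in J then p * r j else 1 - p) =
  pattern_prob n J * \prod_(j in J) r j.
Proof.
rewrite (bigID (mem J))/=.
under eq_bigr => j jJ do rewrite jJ.
under [X in _ * X]eq_bigr => j jJ do rewrite (negbTE jJ).
rewrite big_split/= !prodr_const mulrAC; congr (_ * _ ^+ _ * _).
have := cardC (mem J); rewrite card_ord => nE.
by rewrite -[X in (X - _)%N]nE addKn; apply: eq_card => j; rewrite !inE.
Qed.

(** A single draw that disagrees with [J] makes the product vanish. An event about the whole pattern
    thus becomes a product of one factor per draw, to which independence applies. *)
Lemma prod_matched n (J : {set 'I_n}) (h : 'I_n -> R -> R) w :
  \prod_(j < n) (if (Z j w).1 then (j \in J)%:R * h j (Z j w).2
                 else (j \notin J)%:R) =
  (matched n w == J)%:R * \prod_(j in J) h j (Z j w).2.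
Proof.
have inm (j : 'I_n) : (j \in matched n w) = (Z j w).1 by rewrite inE.
case: eqP => [<-|neq].
  rewrite mul1r (bigID (mem (matched n w)))/= [X in _ * X]big1; last first.
    by move=> j; rewrite inm => /negbTE ->.
  by rewrite mulr1; apply: eq_bigr => j; rewrite inm => ->; rewrite mul1r.
rewrite mul0r; have [j jJ] : exists j : 'I_n, (Z j w).1 != (j \in J).
  apply/existsP; rewrite -negb_forall; apply/negP => /forallP H; apply: neq.
  by apply/setP => j; rewrite inE; have /eqP := H j.
rewrite (bigD1 j)//=; case: ifP jJ => _; case: (j \in J) => //= _.
  by rewrite !mul0r.
by rewrite mul0r.
Qed.

(** This expresses, without conditional laws, that given the pattern [J] the matching values are
    i.i.d. with law [D]. *)
Lemma integral_pattern n (J : {set 'I_n}) (h : 'I_n -> R -> R) (r : 'I_n -> R) :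
  (forall j, measurable_fun setT (h j)) -> (forall j x, 0 <= h j x) ->
  (forall j, (\int[D]_x (h j x)%:E = (r j)%:E)%E) ->
  (\int[P]_w ((matched n w == J)%:R * \prod_(j in J) h j (Z j w).2)%:E =
   (pattern_prob n J * \prod_(j in J) r j)%:E)%E.
Proof.
move=> mh h0 hr.
(* The factors are extended through [inord] to [nat], the index type of the draws; this requires an
   inhabited ordinal type, so [n = 0] is treated apart. *)
case: n J h r mh h0 hr => [|n] J h r mh h0 hr.
  have EJ (A B : {set 'I_0}) : A = B by apply/setP => -[].
  rewrite (EJ J finset.set0) /pattern_prob !big_set0 cards0 !mulr1.
  under eq_integral => w _
    do rewrite (EJ (matched 0 w) finset.set0) eqxx big_set0 mulr1.
  by rewrite integral_cst//= probability_setT mule1.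
pose h' (i : nat) := h (inord i); pose b (i : nat) := inord i \in J.
pose f i (z : bool * R) := if z.1 then (b i)%:R * h' i z.2 else (~~ b i)%:R : R.
pose s i := if b i then p * r (inord i) else 1 - p.
have mf i : measurable_fun setT (f i).
  apply: measurable_fun_ifT => //; apply: measurable_funM => //.
  by apply: measurableT_comp => //; exact: mh.
have f0 i x : 0 <= f i x.
  by rewrite /f; case: ifP => // _; rewrite mulr_ge0//; exact: h0.
have fs i : (\int[P]_w (f i (Z i w))%:E = (s i)%:E)%E.
  rewrite /f /s (@integral_draw i (fun x => (b i)%:R * h' i x) _
    ((b i)%:R * r (inord i)))//.
  - by case: (b i) => /=; rewrite ?(mul0r,mul1r,mulr0,mulr1,addr0,add0r).
  - by apply: measurable_funM => //; exact: mh.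
  - by move=> x; rewrite mulr_ge0//; exact: h0.
  - under eq_integral do rewrite EFinM.
    rewrite ge0_integralZl_EFin// ?hr//.
      by move=> x _; rewrite lee_fin; exact: h0.
    by apply/measurable_EFinP; exact: mh.
have := @integral_prod_independent _ _ _ P _ _ _ Z f s (index_iota 0 n.+1)
  indepZ (iota_uniq _ _) mf f0 fs.
rewrite big_mkord -prod_pattern_prob => H.
transitivity (\int[P]_w (\prod_(0 <= i < n.+1) f i (Z i w))%:E)%E.
  apply: eq_integral => w _; rewrite -prod_matched big_mkord; congr EFin.
  by apply: eq_bigr => j _; rewrite /f /b /h' inord_val.
rewrite H; congr EFin; apply: eq_bigr => j _; by rewrite /s /b inord_val.
Qed.

(** All the factors of [integral_pattern] but one are taken equal to 1, whose integral is 1 because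
    [D] is a probability. *)
Lemma integral_pattern1 n (J : {set 'I_n}) (i : 'I_n) (h : R -> R) (r : R) :
  i \in J -> measurable_fun setT h -> (forall x, 0 <= h x) ->
  (\int[D]_x (h x)%:E = r%:E)%E ->
  (\int[P]_w ((matched n w == J)%:R * h (Z i w).2)%:E =
   (pattern_prob n J * r)%:E)%E.
Proof.
move=> iJ mh h0 hr.
pose H (l : 'I_n) := if l == i then h else fun=> 1.
pose q (l : 'I_n) := if l == i then r else 1.
have prodi (A : 'I_n -> R) : (forall l, l != i -> A l = 1) ->
    \prod_(l in J) A l = A i.
  move=> A1; rewrite (bigD1 i)//= big1 ?mulr1// => l /andP[_ li]; exact: A1.
transitivity (\int[P]_w ((matched n w == J)%:R *
    \prod_(j in J) H j (Z j w).2)%:E)%E.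
  apply: eq_integral => w _; rewrite (prodi (fun l => H l (Z l w).2)).
    by rewrite /H eqxx.
  by move=> l /negbTE li; rewrite /H li.
rewrite (@integral_pattern _ _ H q).
- by rewrite prodi ?/q ?eqxx// => l /negbTE ->.
- by move=> l; rewrite /H; case: ifP.
- by move=> l x; rewrite /H; case: ifP.
- move=> l; rewrite /H /q; case: ifP => // _.
  by rewrite integral_cst//= probability_setT mule1.
Qed.

Lemma integral_pattern2 n (J : {set 'I_n}) (i j : 'I_n) (g h : R -> R)
    (r s : R) :
  i \in J -> j \in J -> i != j ->
  measurable_fun setT g -> (forall x, 0 <= g x) ->
  measurable_fun setT h -> (forall x, 0 <= h x) ->
  (\int[D]_x (g x)%:E = r%:E)%E -> (\int[D]_x (h x)%:E = s%:E)%E ->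
  (\int[P]_w ((matched n w == J)%:R * (g (Z i w).2 * h (Z j w).2))%:E =
   (pattern_prob n J * (r * s))%:E)%E.
Proof.
move=> iJ jJ ij mg g0 mh h0 gr hs.
pose H (l : 'I_n) := if l == i then g else if l == j then h else fun=> 1.
pose q (l : 'I_n) := if l == i then r else if l == j then s else 1.
have ji : (j == i) = false by rewrite eq_sym (negbTE ij).
have prodij (A : 'I_n -> R) : (forall l, l != i -> l != j -> A l = 1) ->
    \prod_(l in J) A l = A i * A j.
  move=> A1; rewrite (bigD1 i)//= (bigD1 j)/=; last by rewrite jJ ji.
  by rewrite big1 ?mulr1// => l /andP[/andP[_ li] lj]; exact: A1.
transitivity (\int[P]_w ((matched n w == J)%:R *
    \prod_(j in J) H j (Z j w).2)%:E)%E.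
  apply: eq_integral => w _; rewrite (prodij (fun l => H l (Z l w).2)).
    by rewrite /H !eqxx ji.
  by move=> l /negbTE li /negbTE lj; rewrite /H li lj.
rewrite (@integral_pattern _ _ H q).
- by rewrite prodij ?/q ?eqxx ?ji// => l /negbTE -> /negbTE ->.
- by move=> l; rewrite /H; case: ifP => // _; case: ifP.
- by move=> l x; rewrite /H; case: ifP => // _; case: ifP.
- move=> l; rewrite /H /q; case: ifP => // _; case: ifP => // _.
  by rewrite integral_cst//= probability_setT mule1.
Qed.

Variables (m a s2 : R).
(** That [m] is the mean is expressed by the equality of two nonnegative integrals, those of the
    positive and negative parts of [x - m]. *)
Hypothesis pos_part : (\int[D]_x (Num.max (x - m) 0)%:E = a%:E)%E.
Hypothesis neg_part : (\int[D]_x (Num.max (m - x) 0)%:E = a%:E)%E.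
Hypothesis second_moment : (\int[D]_x ((x - m) ^+ 2)%:E = s2%:E)%E.

Lemma measurable_matched n (J : {set 'I_n}) :
  measurable_fun setT (fun w => (matched n w == J)%:R : R).
Proof.
(* The indicator of a pattern is the product of [prod_matched] with every [h] equal to 1. *)
have -> : (fun w => (matched n w == J)%:R : R) = fun w =>
    \prod_(j < n) (if (Z j w).1 then (j \in J)%:R * 1 else (j \notin J)%:R).
  apply/funext => w; rewrite (@prod_matched n J (fun _ _ => 1)) big1 ?mulr1//.
apply: measurable_prod => j _; apply: measurable_fun_ifT => //.
exact: measurable_match.
Qed.

Lemma measurable_matched_sum n (J : {set 'I_n}) (x : R) :
  measurable_fun setT (fun w => \sum_(j in J) ((Z j w).2 - x)).
Proof.
under eq_fun do rewrite -big_enum/=.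
apply: measurable_sum => j; apply: measurable_funB => //.
exact: measurable_value.
Qed.

(* Integrability is avoided by writing [x - m = u x - v x] with [u, v >= 0] and
   summing [y_i y_j + (u_i v_j + v_i u_j) = u_i u_j + v_i v_j] over i and j: all
   the integrands are then nonnegative, and the off-diagonal ones cancel because
   [u] and [v] have the same integral. *)
Lemma integral_pattern_sum_sqr n (J : {set 'I_n}) :
  (\int[P]_w ((matched n w == J)%:R *
     (\sum_(j in J) ((Z j w).2 - m)) ^+ 2)%:E =
   (pattern_prob n J * (#|J|%:R * s2))%:E)%E.
Proof.
pose u x := Num.max (x - m) 0; pose v x := Num.max (m - x) 0.
have u0 x : 0 <= u x by rewrite le_max lexx orbT.
have v0 x : 0 <= v x by rewrite le_max lexx orbT.
have mu : measurable_fun setT u.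
  by apply: measurable_maxr => //; exact: measurable_funB.
have mv : measurable_fun setT v.
  by apply: measurable_maxr => //; exact: measurable_funB.
have uvE x : x - m = u x - v x.
  by rewrite /u /v; case: leP => ?; case: leP => ?; lra.
have uv0 x : u x * v x = 0.
  by rewrite /u /v; case: leP => ?; case: leP => ?; nra.
have uuvv x : u x * u x + v x * v x = (x - m) ^+ 2.
  by rewrite uvE sqrrB uv0 mul0rn subr0 !expr2.
pose U j w := u (Z j w).2; pose V j w := v (Z j w).2.
pose ind w : R := (matched n w == J)%:R.
have ind0 w : 0 <= ind w by [].
have mind : measurable_fun setT ind by exact: measurable_matched.
have mU j : measurable_fun setT (U j).
  by apply: (measurableT_comp mu); exact: measurable_value.
have mV j : measurable_fun setT (V j).
  by apply: (measurableT_comp mv); exact: measurable_value.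
pose F (ij : 'I_n * 'I_n) w :=
  ind w * (U ij.1 w * V ij.2 w + V ij.1 w * U ij.2 w).
pose G (ij : 'I_n * 'I_n) w :=
  ind w * (U ij.1 w * U ij.2 w + V ij.1 w * V ij.2 w).
have mF ij : measurable_fun setT (F ij).
  apply: measurable_funM => //.
  by apply: measurable_funD; exact: measurable_funM.
have mG ij : measurable_fun setT (G ij).
  apply: measurable_funM => //.
  by apply: measurable_funD; exact: measurable_funM.
have F0 ij w : 0 <= F ij w.
  by apply: mulr_ge0 => //; apply: addr_ge0; apply: mulr_ge0; rewrite ?u0 ?v0.
have G0 ij w : 0 <= G ij w.
  by apply: mulr_ge0 => //; apply: addr_ge0; apply: mulr_ge0; rewrite ?u0 ?v0.
have split2 (f1 f2 : Omega -> R) (r1 r2 : R) :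
    measurable_fun setT f1 -> measurable_fun setT f2 ->
    (forall w, 0 <= f1 w) -> (forall w, 0 <= f2 w) ->
    (\int[P]_w (ind w * f1 w)%:E = r1%:E)%E ->
    (\int[P]_w (ind w * f2 w)%:E = r2%:E)%E ->
    (\int[P]_w (ind w * (f1 w + f2 w))%:E = (r1 + r2)%:E)%E.
  move=> mf1 mf2 f10 f20 fr1 fr2; under eq_integral do rewrite mulrDr EFinD.
  rewrite ge0_integralD ?fr1 ?fr2 ?EFinD//.
  - by move=> w _; rewrite lee_fin mulr_ge0.
  - by apply/measurable_EFinP; exact: measurable_funM.
  - by move=> w _; rewrite lee_fin mulr_ge0.
  - by apply/measurable_EFinP; exact: measurable_funM.
pose Q (ij : 'I_n * 'I_n) := (ij.1 \in J) && (ij.2 \in J).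
(* The diagonal of [F] vanishes because [u x * v x = 0], while that of [G] gives [(x - m) ^+ 2];
   hence [cG - cF] is [pattern_prob n J * s2] on the diagonal and 0 elsewhere. *)
pose cF (ij : 'I_n * 'I_n) :=
  if ij.1 == ij.2 then 0
  else pattern_prob n J * (a * a) + pattern_prob n J * (a * a).
pose cG (ij : 'I_n * 'I_n) :=
  if ij.1 == ij.2 then pattern_prob n J * s2
  else pattern_prob n J * (a * a) + pattern_prob n J * (a * a).
have intF ij : Q ij -> (\int[P]_w (F ij w)%:E = (cF ij)%:E)%E.
  case: ij => i j /andP[/= iJ jJ]; rewrite /F /cF/=; case: eqVneq => [->|ij].
    rewrite integral0_eq// => w _; rewrite /U /V uv0 [v _ * _]mulrC uv0 addr0.
    by rewrite mulr0.
  apply: split2.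
  - exact: measurable_funM.
  - exact: measurable_funM.
  - by move=> w; apply: mulr_ge0; rewrite ?u0 ?v0.
  - by move=> w; apply: mulr_ge0; rewrite ?u0 ?v0.
  - exact: (@integral_pattern2 _ J i j u v).
  - exact: (@integral_pattern2 _ J i j v u).
have intG ij : Q ij -> (\int[P]_w (G ij w)%:E = (cG ij)%:E)%E.
  case: ij => i j /andP[/= iJ jJ]; rewrite /G /cG/=; case: eqVneq => [->|ij].
    under eq_integral => w _ do rewrite /U /V uuvv.
    apply: (@integral_pattern1 _ _ _ (fun x => (x - m) ^+ 2)) => //.
    + by apply: measurable_funX; exact: measurable_funB.
    + by move=> x; exact: sqr_ge0.
  apply: split2.
  - exact: measurable_funM.
  - exact: measurable_funM.
  - by move=> w; apply: mulr_ge0; rewrite ?u0 ?v0.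
  - by move=> w; apply: mulr_ge0; rewrite ?u0 ?v0.
  - exact: (@integral_pattern2 _ J i j u u).
  - exact: (@integral_pattern2 _ J i j v v).
have sumF := @ge0_integral_sum_EFin _ _ _ P _ Q F cF mF F0 intF.
have sumG := @ge0_integral_sum_EFin _ _ _ P _ Q G cG mG G0 intG.
have key w : ind w * (\sum_(j in J) ((Z j w).2 - m)) ^+ 2 +
    \sum_(ij | Q ij) F ij w = \sum_(ij | Q ij) G ij w.
  rewrite expr2 big_distrlr/= pair_big/= mulr_sumr -big_split/=.
  apply: eq_bigr => -[i j] _; rewrite /F /G/= -mulrDr; congr (_ * _).
  by rewrite !uvE /U /V; ring.
have : (\int[P]_w (ind w * (\sum_(j in J) ((Z j w).2 - m)) ^+ 2)%:E +
    (\sum_(ij | Q ij) cF ij)%:E = (\sum_(ij | Q ij) cG ij)%:E)%E.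
  rewrite -sumF -ge0_integralD//.
  - by rewrite -sumG; apply: eq_integral => w _; rewrite -EFinD key.
  - by move=> w _; rewrite lee_fin mulr_ge0// sqr_ge0.
  - apply/measurable_EFinP; apply: measurable_funM => //.
    by apply: measurable_funX; exact: measurable_matched_sum.
  - by move=> w _; rewrite lee_fin sumr_ge0.
  - apply/measurable_EFinP; under eq_fun do rewrite -big_enum/=.
    exact: measurable_sum.
(* The right-hand side is finite, so the unknown integral is a real number and the sum of [cF] can
   be subtracted. *)
case: (\int[P]_w _)%E => [x| |]//= [xE]; congr EFin.
have {xE} -> : x = \sum_(ij | Q ij) (cG ij - cF ij).
  by rewrite sumrB -xE addrK.
rewrite -(pair_big (mem J) (mem J) (fun i j => cG (i, j) - cF (i, j)))/=.
rewrite mulrCA mulr_natl -sumr_const; apply: eq_bigr => i iJ.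
rewrite (bigD1 i)//= big1 ?addr0; first by rewrite /cG /cF/= eqxx subr0.
by move=> j /andP[_ ji]; rewrite /cG /cF/= eq_sym (negbTE ji) subrr.
Qed.

(** * Sample mean and binomial law of the number of matches *)

Lemma sample_mean_matched n w :
  sample_mean (matching_values (fun j => Z j w) n) =
  (\sum_(j in matched n w) (Z j w).2) / #|matched n w|%:R.
Proof.
have iotaE : iota 0 n = index_iota 0 n by rewrite /index_iota subn0.
have sE : size (matching_values (fun j => Z j w) n) = #|matched n w|.
  rewrite size_map size_filter -sum1_count -sum1_card.
  rewrite iotaE big_mkord.
  by apply: eq_bigl => j; rewrite inE.
have ME : \sum_(y <- matching_values (fun j => Z j w) n) y =
    \sum_(j in matched n w) (Z j w).2.
  rewrite big_map big_filter iotaE big_mkord.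
  by apply: eq_bigl => j; rewrite inE.
(* Without any match, the inverse of 0 is 0, so the quotient agrees with the default value of
   [sample_mean]. *)
rewrite /sample_mean sE ME; case: ltnP => //.
by rewrite leqn0 => /eqP ->; rewrite invr0 mulr0.
Qed.

Lemma sum_matched n w (F : {set 'I_n} -> R) :
  \sum_J (matched n w == J)%:R * F J = F (matched n w).
Proof.
rewrite (bigD1 (matched n w))//= eqxx mul1r big1 ?addr0// => J.
by rewrite eq_sym => /negbTE ->; rewrite mul0r.
Qed.

(** The set of summed indices is random; a finite case split over the patterns makes it constant in
    each piece. *)
Lemma measurable_sample_mean n :
  measurable_fun setT
    (fun w => sample_mean (matching_values (fun j => Z j w) n)).
Proof.
have -> : (fun w => sample_mean (matching_values (fun j => Z j w) n)) =
    fun w => \sum_J (matched n w == J)%:R *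
      ((\sum_(j in J) ((Z j w).2 - 0)) / #|J|%:R).
  apply/funext => w; rewrite sum_matched sample_mean_matched.
  by under [in RHS]eq_bigr do rewrite subr0.
apply: measurable_sum => J; apply: measurable_funM.
  exact: measurable_matched.
by apply: measurable_funM => //; exact: measurable_matched_sum.
Qed.

(** Grouping the patterns by cardinality produces the binomial law. *)
Lemma sum_pattern_prob n (F : nat -> R) :
  \sum_(J : {set 'I_n}) pattern_prob n J * F #|J| =
  \sum_(b < n.+1) ((1 - p) ^+ (n - b) * p ^+ b *+ 'C(n, b)) * F b.
Proof.
have ltn (J : {set 'I_n}) : (#|J| < n.+1)%N.
  by rewrite ltnS -[X in (_ <= X)%N]card_ord max_card.
rewrite (partition_big (fun J => Ordinal (ltn J)) xpredT)//=.
apply: eq_bigr => b _.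
transitivity
    (\sum_(J : {set 'I_n} | #|J| == b) (1 - p) ^+ (n - b) * p ^+ b * F b).
  apply: eq_big => // J /eqP <-.
  by rewrite /pattern_prob mulrC [p ^+ _ * _]mulrC mulrC.
rewrite sumr_const -[LHS]mulrnAl; congr (_ *+ _ * _).
have := card_draws 'I_n b; rewrite card_ord => <-.
by apply: eq_card => J; rewrite !inE.
Qed.

(** Both parts bound E[1/(B+1)] for a binomial B. For the second one, [n] is enlarged to [n.+1];
    since (n+1) C(n,b) / (b+1) = C(n+1,b+1), the sum becomes the total binomial mass for [n.+1]
    without its term of index 0. *)
Lemma sum_pattern_prob_inv n :
  \sum_(J : {set 'I_n}) pattern_prob n J * (#|J|.+1%:R)^-1 <= 1 /\
  (n%:R * p) * \sum_(J : {set 'I_n}) pattern_prob n J * (#|J|.+1%:R)^-1 <= 1.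
Proof.
have /andP[p0 p1] := p01; have q0 : 0 <= 1 - p by rewrite subr_ge0.
rewrite (sum_pattern_prob n (fun b => (b.+1%:R)^-1)).
have one k : \sum_(b < k.+1) (1 - p) ^+ (k - b) * p ^+ b *+ 'C(k, b) = 1.
  by rewrite -exprDn subrK expr1n.
have t0 k b : 0 <= (1 - p) ^+ (k - b) * p ^+ b *+ 'C(k, b).
  by rewrite mulrn_wge0// mulr_ge0// exprn_ge0.
have S0 : 0 <= \sum_(b < n.+1)
    ((1 - p) ^+ (n - b) * p ^+ b *+ 'C(n, b)) * (b.+1%:R)^-1.
  by apply: sumr_ge0 => b _; rewrite mulr_ge0.
split.
  rewrite -[leRHS](one n); apply: ler_sum => b _.
  by rewrite ler_piMr// invf_le1// ler1n.
apply: (@le_trans _ _ ((n.+1%:R * p) * \sum_(b < n.+1)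
    ((1 - p) ^+ (n - b) * p ^+ b *+ 'C(n, b)) * (b.+1%:R)^-1)).
  by rewrite ler_wpM2r// ler_wpM2r// ler_nat.
rewrite -[leRHS](one n.+1) [leRHS]big_ord_recl/= mulr_sumr.
rewrite -[leLHS]add0r lerD//; apply: ler_sum => b _.
rewrite /bump/= add1n subSS exprSr -!(mulr_natr (_ * _)).
have -> : 'C(n.+1, b.+1)%:R = n.+1%:R * 'C(n, b)%:R / b.+1%:R :> R.
  by rewrite -natrM mul_bin_diag natrM mulrAC divff ?mul1r// pnatr_eq0.
by rewrite le_eqVlt; apply/orP; left; apply/eqP; ring.
Qed.

(** Given B matches, the mean squared error is [m ^+ 2] if B = 0, because the estimate is then 0,
    and [s2] / B otherwise. Both are at most ([m ^+ 2 + 2 * s2]) / (B+1), as 1/B is at most 2/(B+1)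
    for B >= 1; [sum_pattern_prob_inv] concludes. *)
Lemma sample_mean_mse n :
  exists2 e : R,
    (\int[P]_w ((sample_mean (matching_values (fun j => Z j w) n) - m) ^+ 2)%:E
     = e%:E)%E &
    e <= m ^+ 2 + 2 * s2 /\ (n%:R * p) * e <= m ^+ 2 + 2 * s2.
Proof.
have /andP[p0 p1] := p01.
have s20 : 0 <= s2.
  rewrite -lee_fin -second_moment; apply: integral_ge0 => x _.
  by rewrite lee_fin sqr_ge0.
(* One nonnegative piece per pattern: the pieces add up to the squared error, and the integral of
   [err J] is [r J]. *)
pose err (J : {set 'I_n}) w := (matched n w == J)%:R *
  (if J == finset.set0 then m ^+ 2
   else (\sum_(j in J) ((Z j w).2 - m)) ^+ 2 * (#|J|%:R ^- 2)).
pose r (J : {set 'I_n}) : R := pattern_prob n J *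
  (if J == finset.set0 then m ^+ 2 else s2 / #|J|%:R).
have merr J : measurable_fun setT (err J).
  apply: measurable_funM; first exact: measurable_matched.
  case: (J == finset.set0); first exact: measurable_cst.
  apply: measurable_funM => //; apply: measurable_funX.
  exact: measurable_matched_sum.
have err0 J w : 0 <= err J w.
  rewrite mulr_ge0//; case: ifP => _; first exact: sqr_ge0.
  by rewrite mulr_ge0// ?sqr_ge0// invr_ge0 sqr_ge0.
exists (\sum_J r J).
  rewrite -(@ge0_integral_sum_EFin _ _ _ P _ xpredT err)//.
    apply: eq_integral => w _; congr EFin; rewrite sum_matched.
    case: eqVneq => [M0|M0].
      by rewrite sample_mean_matched M0 big_set0 mul0r sub0r sqrrN.
    have c0 : #|matched n w|%:R != 0 :> R by rewrite pnatr_eq0 cards_eq0.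
    rewrite -exprVn -exprMn; congr (_ ^+ 2).
    rewrite sample_mean_matched sumrB mulrBl; congr (_ - _).
    by rewrite sumr_const -[m *+ _]mulr_natr mulfK.
  move=> J _; rewrite /err /r; case: eqVneq => [->|J0].
    under eq_integral => w _ do rewrite mulrC EFinM.
    rewrite ge0_integralZl_EFin ?sqr_ge0//; first last.
    - by apply/measurable_EFinP; exact: measurable_matched.
    - rewrite [X in _ = X]EFinM.
      have := @integral_pattern n finset.set0 (fun _ _ => 1) (fun=> 1).
      rewrite !big_set0 mulr1 => <-//.
      + rewrite [RHS]muleC; congr (_ * _)%E.
        by apply: eq_integral => w _; rewrite ?big_set0 ?mulr1.
      + by move=> _; rewrite integral_cst//= probability_setT mule1.
  under eq_integral => w _ do rewrite mulrA mulrC EFinM.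
  rewrite ge0_integralZl_EFin//; last 2 first.
  - by move=> w _; rewrite lee_fin mulr_ge0// sqr_ge0.
  - apply/measurable_EFinP.
    apply: measurable_funM; first exact: measurable_matched.
    by apply: measurable_funX; exact: measurable_matched_sum.
  rewrite integral_pattern_sum_sqr -EFinM; congr EFin.
  have c0 : #|J|%:R != 0 :> R by rewrite pnatr_eq0 cards_eq0.
  by field.
have rle J : r J <= (m ^+ 2 + 2 * s2) * (pattern_prob n J * (#|J|.+1%:R)^-1).
  rewrite mulrCA; apply: ler_wpM2l; first exact: pattern_prob_ge0.
  case: eqVneq => [->|J0]; first by rewrite cards0 invr1 mulr1; lra.
  have c0 : (1 <= #|J|%:R :> R) by rewrite ler1n card_gt0.
  have m20 := sqr_ge0 m.
  rewrite ler_pdivrMr; last by lra.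
  rewrite mulrAC ler_pdivlMr; last by rewrite ltr0n.
  rewrite -natr1; nra.
have [A1 A2] := sum_pattern_prob_inv n.
have B0 : 0 <= m ^+ 2 + 2 * s2 by have := sqr_ge0 m; lra.
have sumr_le : \sum_J r J <= (m ^+ 2 + 2 * s2) *
    \sum_(J : {set 'I_n}) pattern_prob n J * (#|J|.+1%:R)^-1.
  by rewrite mulr_sumr; apply: ler_sum => J _; exact: rle.
split; first by apply: (le_trans sumr_le); rewrite ler_piMr.
apply: (@le_trans _ _ ((n%:R * p) * ((m ^+ 2 + 2 * s2) *
    \sum_(J : {set 'I_n}) pattern_prob n J * (#|J|.+1%:R)^-1))).
  by rewrite ler_wpM2l// mulr_ge0.
by rewrite mulrCA ler_piMr.
Qed.

End one_stratum.

(** * Centered moments of a law from bounds on its moments *)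

(** The bounded absolute moment makes the identity integrable, so [x - law_mean D] has integral 0;
    its positive and negative parts then have finite and equal integrals. *)
Lemma integral_centered_parts (R : realType) (D : probability R R) (C : R) :
  ('E_D[fun x : R => `|x|%R] <= C%:E)%E ->
  exists2 a : R,
    (\int[D]_x (Num.max (x - law_mean D) 0)%:E = a%:E)%E &
    (\int[D]_x (Num.max (law_mean D - x) 0)%:E = a%:E)%E.
Proof.
move=> EC; pose m := law_mean D.
have iid : D.-integrable setT (EFin : R -> \bar R).
  apply/integrableP; split; first exact/measurable_EFinP.
  apply: (@le_lt_trans _ _ C%:E); last exact: ltry.
  by move: EC; rewrite unlock; apply: le_trans.
have im : D.-integrable setT (cst m%:E : R -> \bar R).
  apply/integrableP; split => //.
  under eq_integral do rewrite abse_EFin.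
  by rewrite integral_cst//= probability_setT mule1 ltry.
have mE : (\int[D]_x x%:E = m%:E)%E.
  have fin : (\int[D]_x x%:E)%E \is a fin_num by exact: integrable_fin_num.
  by rewrite /m /law_mean unlock fineK.
have iB : D.-integrable setT (fun x : R => (x - m)%:E).
  by have := integrableB measurableT iid im.
have B0 : (\int[D]_x (x - m)%:E = 0)%E.
  under eq_integral do rewrite EFinB.
  by rewrite integralB// mE integral_cst//= probability_setT mule1 subee.
pose f x := (x - m)%:E.
have posE : (\int[D]_x (Num.max (x - m) 0)%:E = \int[D]_x (f^\+ x))%E.
  by apply: eq_integral => x _; rewrite funeposE /f EFin_max.
have negE : (\int[D]_x (Num.max (m - x) 0)%:E = \int[D]_x (f^\- x))%E.
  by apply: eq_integral => x _; rewrite funenegE /f -EFinN opprB EFin_max.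
have finp := integrable_pos_fin_num measurableT iB.
have finn := integrable_neg_fin_num measurableT iB.
have E : (\int[D]_x f^\+ x - \int[D]_x f^\- x = 0)%E.
  by rewrite -[RHS]B0 [RHS]integralE.
exists (fine (\int[D]_x (f^\+ x))%E); first by rewrite posE fineK.
rewrite negE fineK//; move: E finp finn; rewrite -/f.
case: (\int[D]_x f^\+ x)%E => [x| |]//; case: (\int[D]_x f^\- x)%E => [y| |]//.
by move=> [/eqP]; rewrite subr_eq0 => /eqP ->.
Qed.

(** The integrand is nonnegative, so the bound on the variance gives finiteness, and [fine] loses
    nothing. *)
Lemma integral_centered_sqr (R : realType) (D : probability R R) (C : R) :
  ('V_D[id] <= C%:E)%E ->
  exists s2 : R, (\int[D]_x ((x - law_mean D) ^+ 2)%:E = s2%:E)%E.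
Proof.
move=> VC; exists (fine (\int[D]_x ((x - law_mean D) ^+ 2)%:E)%E).
rewrite fineK// ge0_fin_numE; last first.
  by apply: integral_ge0 => x _; rewrite lee_fin sqr_ge0.
apply: (@le_lt_trans _ _ C%:E); last exact: ltry.
move: VC; rewrite /variance unlock unlock; apply: le_trans.
rewrite le_eqVlt; apply/orP; left; apply/eqP.
by apply: eq_integral => x _; rewrite expr2 /law_mean unlock.
Qed.

(** * Combining the strata *)

(** Each product [a i * a j] is at most [(a i ^+ 2 + a j ^+ 2) / 2]; the sum of these means over all
    pairs is the right-hand side. *)
Lemma sqr_sum_le (R : realType) (K : nat) (a : 'I_K -> R) :
  (\sum_k a k) ^+ 2 <= K%:R * \sum_k (a k) ^+ 2.
Proof.
have -> : K%:R * \sum_k (a k) ^+ 2 =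
    \sum_(i < K) \sum_(j < K) ((a i) ^+ 2 + (a j) ^+ 2) / 2.
  under [RHS]eq_bigr do rewrite -mulr_suml big_split/= sumr_const card_ord.
  rewrite -mulr_suml big_split/= sumr_const card_ord sumrMnl.
  by rewrite -mulr2n -[X in _ = X / _]mulr_natr mulfK ?pnatr_eq0// mulr_natl.
rewrite expr2 big_distrlr/=; apply: ler_sum => i _; apply: ler_sum => j _.
have := sqr_ge0 (a i - a j); nra.
Qed.

(* [w], [e] and [n] stand for the weight, the mean squared error and the Stage 2
   sample size of one stratum; strata with [p <= A0 / N1] have weight O(1/N1),
   the others have weight O(p). *)
Lemma weighted_mse_le (R : realType) (p w e n B L c Cp tau A0 N1 N2 : R) :
  0 <= p <= 1 -> 0 < Cp -> 0 <= L -> 0 <= c -> 0 < tau -> 1 <= A0 ->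
  1 <= N1 -> 0 < N2 -> 0 <= e -> e <= B -> (n * p) * e <= B ->
  0 <= w -> w <= p / Cp + c * (L * Num.sqrt p / Num.sqrt N1) ->
  (A0 / N1 < p -> N2 * (tau * Num.sqrt p / 2) <= n) ->
  w ^+ 2 * e <= (A0 / Cp + c * L * Num.sqrt A0) ^+ 2 * B * N1^-1 +
    2 * (Cp^-1 + c * L) ^+ 2 * B / tau * N2^-1.
Proof.
move=> /andP[p0 p1] Cp0 L0 c0 tau0 A01 N11 N20 e0 eB nB w0 wle nle.
have N10 : 0 < N1 by lra.
have cL0 : 0 <= c * L by rewrite mulr_ge0.
have B0 : 0 <= B by lra.
have s0 : 0 <= Num.sqrt p by rewrite sqrtr_ge0.
have ss : Num.sqrt p * Num.sqrt p = p by rewrite -expr2 sqr_sqrtr.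
have t0 : 0 < Num.sqrt N1 by rewrite sqrtr_gt0.
have tt : Num.sqrt N1 * Num.sqrt N1 = N1 by rewrite -expr2 sqr_sqrtr ?ltW.
set G1 := A0 / Cp + _; set G2 := Cp^-1 + _.
have N1V : 0 <= N1^-1 by rewrite invr_ge0 ltW.
have N2V : 0 <= N2^-1 by rewrite invr_ge0 ltW.
have tauV : 0 <= tau^-1 by rewrite invr_ge0 ltW.
have CpV : 0 <= Cp^-1 by rewrite invr_ge0 ltW.
have A00 : 0 <= A0 by lra.
have G10 : 0 <= G1 by apply: addr_ge0; apply: mulr_ge0; rewrite ?sqrtr_ge0.
have G20 : 0 <= G2 by apply: addr_ge0.
have r1 : 0 <= G1 ^+ 2 * B * N1^-1.
  by apply: mulr_ge0 => //; apply: mulr_ge0 => //; exact: sqr_ge0.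
have r2 : 0 <= 2 * G2 ^+ 2 * B / tau * N2^-1.
  do 3 (apply: mulr_ge0 => //).
  by apply: mulr_ge0 => //; exact: sqr_ge0.
have [pA|pA] := leP p (A0 / N1).
  (* Squaring gives [N1 ^- 2], which is at most [N1^-1] because [1 <= N1]; the error [e] is bounded
     by [B]. *)
  suff H : w <= G1 / N1.
    apply: (@le_trans _ _ (G1 ^+ 2 * B * N1^-1)); last by lra.
    rewrite [leRHS]mulrAC; apply: ler_pM => //; first exact: sqr_ge0.
    apply: (@le_trans _ _ ((G1 / N1) ^+ 2)).
      by rewrite ler_pXn2r// nnegrE ?divr_ge0// ltW.
    rewrite expr_div_n ler_wpM2l ?sqr_ge0// lef_pV2 ?posrE ?exprn_gt0//.
    by rewrite expr2 ler_peMr//; lra.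
  apply: (le_trans wle); rewrite /G1 mulrDl; apply: lerD.
    by rewrite mulrAC ler_pM2r ?invr_gt0.
  rewrite !mulrA -!mulrA !ler_wpM2l//.
  have sA : Num.sqrt p <= Num.sqrt A0 / Num.sqrt N1.
    by rewrite -(sqrtrV (ltW N10)) -sqrtrM//; exact: ler_wsqrtr.
  apply: (@le_trans _ _ (Num.sqrt A0 / Num.sqrt N1 / Num.sqrt N1)).
    by rewrite ler_wpM2r// invr_ge0 ltW.
  by rewrite -mulrA -invfM tt.
(* The bound on [n * p * e] controls [Num.sqrt p * (p * e)], and the remaining factor [Num.sqrt p]
   of [p ^+ 2 * e] is at most 1. *)
suff H : w <= G2 * p.
  apply: (@le_trans _ _ (2 * G2 ^+ 2 * B / tau * N2^-1)); last by lra.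
  have H2 : w ^+ 2 * e <= G2 ^+ 2 * (p ^+ 2 * e).
    rewrite mulrA -exprMn ler_wpM2r// ler_pXn2r// nnegrE mulr_ge0//.
  apply: (le_trans H2).
  have pe0 : 0 <= p * e by rewrite mulr_ge0.
  have H3 : N2 * (tau * Num.sqrt p / 2) * (p * e) <= B.
    by apply: le_trans nB; rewrite -[leRHS]mulrA ler_wpM2r// nle.
  have H4 : Num.sqrt p * (p * e) <= 2 * B / tau * N2^-1.
    rewrite ler_pdivlMr// ler_pdivlMr//; lra.
  have s1 : Num.sqrt p <= 1 by rewrite -[leRHS]sqrtr1 ler_wsqrtr.
  have -> : 2 * G2 ^+ 2 * B / tau * N2^-1 = G2 ^+ 2 * (2 * B / tau * N2^-1).
    by ring.
  rewrite ler_wpM2l ?sqr_ge0//; apply: le_trans H4.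
  have -> : p ^+ 2 * e = p * (p * e) by ring.
  by rewrite -{1}ss -mulrA ler_piMl// mulr_ge0.
apply: (le_trans wle); rewrite /G2 mulrDl [Cp^-1 * _]mulrC lerD2l -!mulrA.
(* Since [1 <= A0] and [A0 / N1 < p], the inverse of [Num.sqrt N1] is at most [Num.sqrt p]. *)
rewrite !ler_wpM2l// -{2}ss ler_wpM2l// -(sqrtrV (ltW N10)).
apply: ler_wsqrtr; apply: ltW.
by apply: le_lt_trans pA; rewrite ler_peMl.
Qed.

(** In [A0], the summand [4 * c ^+ 2 * L] makes the relative error in (vi) at most 1/2, the last
    group places [p] above [p_star], and the leading 1 ensures [1 <= A0], as [weighted_mse_le]
    asks. *)
Lemma large_p_regime (R : realType) (L c p N1 : R) :
  0 < L -> 0 < N1 ->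
  let A0 := 1 + 4 * c ^+ 2 * L + (2 * L + 2 * Num.sqrt L + 2) in
  A0 / N1 < p ->
  (2 * L + 2 * Num.sqrt L + 2) / N1 < p /\ c * Num.sqrt (L / (p * N1)) <= 2^-1.
Proof.
move=> L0 N10 A0; rewrite ltr_pdivrMr// => A0p.
have sL := sqrtr_ge0 L.
have c2 : 0 <= c ^+ 2 * L by rewrite mulr_ge0 ?sqr_ge0// ltW.
split; first by rewrite ltr_pdivrMr//; move: A0p; rewrite /A0; lra.
have pN : 0 < p * N1 by move: A0p; rewrite /A0; lra.
case: (lerP c 0) => c0.
  apply: (@le_trans _ _ 0); last by rewrite invr_ge0.
  by rewrite mulr_le0_ge0 ?sqrtr_ge0.
rewrite -(@ler_pXn2r _ 2)// ?nnegrE ?invr_ge0//; last first.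
  by rewrite mulr_ge0 ?sqrtr_ge0// ltW.
rewrite exprMn sqr_sqrtr; last by rewrite divr_ge0// ltW.
rewrite mulrA ler_pdivrMr//; move: A0p; rewrite /A0; lra.
Qed.

(** As [p i <= 1], the denominator of the allocation is at most the sum of the [sigma i], so the
    constant in front of [Num.sqrt (p k)] is independent of [p]. *)
Lemma allocation_ge (R : realType) (K : nat) (p sigma : 'I_K -> R) (k : 'I_K) :
  (forall i, 0 <= p i <= 1) -> (forall i, 0 < sigma i) -> 0 < p k ->
  (sigma k / \sum_i sigma i) * Num.sqrt (p k) <= allocation p sigma k.
Proof.
move=> p01 s0 pk0; rewrite /allocation mulrAC [sigma k * _]mulrC.
have t0 i : 0 <= Num.sqrt (p i) * sigma i by rewrite mulr_ge0 ?sqrtr_ge0// ltW.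
rewrite ler_wpM2l ?t0// lef_pV2 ?posrE.
- apply: ler_sum => i _; rewrite ler_piMl ?(ltW (s0 i))//.
  by rewrite -[leRHS]sqrtr1 ler_wsqrtr//; have /andP[] := p01 i.
- by rewrite (bigD1 k)//= ltr_pwDl// sumr_ge0// => i _; exact/ltW.
- rewrite (bigD1 k)//= ltr_pwDl ?sumr_ge0//.
  by rewrite mulr_gt0// sqrtr_gt0.
Qed.

Lemma mutually_independent_stratum d (Omega : measurableType d) (R : realType)
    (P : probability Omega R) d' (T : measurableType d') (I J : eqType)
    (Z : I * J -> Omega -> T) (k : I) :
  mutually_independent P Z -> mutually_independent P (fun j => Z (k, j)).
Proof.
move=> indep s A us mA.
have /indep : uniq [seq (k, j) | j <- s] by rewrite map_inj_uniq// => x y [].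
by move=> /(_ (fun kj => A kj.2)); rewrite !big_map => ->.
Qed.

Lemma w_hat_ge0 (R : realType) (K N1 : nat) (x : 'I_K -> seq R) k :
  0 <= w_hat N1 x k.
Proof.
have p0 i : 0 <= p_hat N1 x i by rewrite divr_ge0.
by rewrite divr_ge0// sumr_ge0.
Qed.

(** Above the threshold of [large_p_regime], condition (vi) holds with a factor at least 1/2, whence
    the division by 2. The ceiling and its absolute value can only increase the size. *)
Lemma stage2_size_ge (R : realType) (K : nat) (c delta : R) (N1 N2 : nat)
    (p sigma : 'I_K -> R) (x : 'I_K -> seq R) (k : 'I_K) :
  (forall i, 0 <= p i <= 1) -> (forall i, 0 < sigma i) ->
  0 < ln delta^-1 -> (0 < N1)%N ->
  stage1_event c delta N1 p sigma x ->
  (1 + 4 * c ^+ 2 * ln delta^-1 +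
     (2 * ln delta^-1 + 2 * Num.sqrt (ln delta^-1) + 2)) / N1%:R < p k ->
  N2%:R * (sigma k / (\sum_i sigma i) * Num.sqrt (p k) / 2) <=
    (stage2_size N1 N2 x k)%:R.
Proof.
move=> p01 s0 L0 N10 ev pk.
have N1R : 0 < N1%:R :> R by rewrite ltr0n.
have [pstar chalf] := @large_p_regime R _ c _ _ L0 N1R pk.
have pk0 : 0 < p k.
  apply: lt_trans pk; rewrite divr_gt0//.
  have sL := sqrtr_ge0 (ln delta^-1).
  have cL : 0 <= c ^+ 2 * ln delta^-1 by rewrite mulr_ge0 ?sqr_ge0// ltW.
  lra.
have Tge := @allocation_ge R K p sigma k p01 s0 pk0.
have That : sigma k / (\sum_i sigma i) * Num.sqrt (p k) / 2 <= T_hat N1 x k.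
  apply: le_trans (ev_T_hat ev pstar).
  have T0 : 0 <= sigma k / (\sum_i sigma i) * Num.sqrt (p k).
    by rewrite !mulr_ge0 ?sqrtr_ge0 ?invr_ge0 ?sumr_ge0// => *; exact/ltW.
  have := chalf; set q := c * _; nra.
have N2R : 0 <= N2%:R :> R by [].
apply: (@le_trans _ _ (N2%:R * T_hat N1 x k)); first by rewrite ler_wpM2l.
apply: (le_trans (Num.Theory.ceil_ge _)).
rewrite /stage2_size natr_absz ler_int; exact: ler_norm.
Qed.

(** * Mean squared error of the stratified estimator *)

Theorem theorem1 (R : realType) (K : nat)
    (Cmu Csigma2 : 'I_K -> R) (Cpall : R)
    (D : 'I_K -> probability R R) (c delta : R) :
  (forall k, 0 < Cmu k) -> (forall k, 0 < Csigma2 k) -> 0 < Cpall ->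
  (forall k, subgaussian (D k)) ->
  (forall k, ('E_(D k)[fun x : R => `|x|%R] <= (Cmu k)%:E)%E) ->
  (forall k, ('V_(D k)[id] <= (Csigma2 k)%:E)%E) ->
  (forall k, 0 < law_stddev (D k)) ->
  0 <= c -> 0 < delta < 1 ->
  exists C1 C2 C3 : R,
  forall N1 N2 : nat -> nat,
  (forall n, (0 < N1 n)%N) ->
  (N2 n)%:R / (N1 n)%:R `^ (3 / 4) @[n --> \oo] --> (+oo : set_system R) ->
  exists N0 : nat,
  forall n : nat, (N0 <= K * N1 n + N2 n)%N ->
  forall p : 'I_K -> R,
  (forall k, 0 <= p k <= 1) -> Cpall <= \sum_(k < K) p k ->
  forall (d1 d2 : measure_display)
    (Omega1 : measurableType d1) (Omega2 : measurableType d2)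
    (P1 : probability Omega1 R) (P2 : probability Omega2 R)
    (Z1 : 'I_K -> nat -> {RV P1 >-> (bool * R)%type})
    (Z2 : 'I_K -> nat -> {RV P2 >-> (bool * R)%type}),
  stratified_draws p D Z1 -> stratified_draws p D Z2 ->
  forall w1 : Omega1,
  let x1 := fun k => matching_values (fun j => Z1 k j w1) (N1 n) in
  stage1_event c delta (N1 n) p (fun k => law_stddev (D k)) x1 ->
  ('E_P2[fun w2 =>
     ((mu_hat_all (N1 n) (N2 n) x1 (fun k j => Z2 k j w2) - mu_all p D) ^+ 2)%R]
   <= (C1 * (N1 n)%:R^-1 + C2 * (N2 n)%:R^-1
       + C3 * ((N1 n)%:R `^ (1 / 2) * (N2 n)%:R `^ (- (3 / 2))))%:E)%E.
Proof.
move=> _ _ Cp0 _ meanC varC s0 c0 /andP[delta0 delta1].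
have [a posD negD] : exists2 a : 'I_K -> R,
    forall k, (\int[D k]_x (Num.max (x - law_mean (D k)) 0)%:E = (a k)%:E)%E &
    forall k, (\int[D k]_x (Num.max (law_mean (D k) - x) 0)%:E = (a k)%:E)%E.
  have H k : exists a : R,
      (\int[D k]_x (Num.max (x - law_mean (D k)) 0)%:E = a%:E)%E /\
      (\int[D k]_x (Num.max (law_mean (D k) - x) 0)%:E = a%:E)%E.
    by have [a] := integral_centered_parts _ _ _ (meanC k); exists a.
  by have [a Ha] := choice H; exists a => k; have [] := Ha k.
have [s2 s2E] := choice (fun k => integral_centered_sqr _ _ _ (varC k)).
set L := ln delta^-1.
have L0 : 0 < L by rewrite ln_gt0// invf_gt1.
pose A0 := 1 + 4 * c ^+ 2 * L + (2 * L + 2 * Num.sqrt L + 2).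
pose mu k := law_mean (D k).
pose B k := mu k ^+ 2 + 2 * s2 k.
pose tau k := law_stddev (D k) / \sum_i law_stddev (D i).
(* [c1] and [c2] are the constants of [weighted_mse_le] with [Cp] equal to [Cpall]; [c3] accounts
   for the error of the weights. None depends on the sample sizes or on [p]. *)
pose c1 k := (A0 / Cpall + c * L * Num.sqrt A0) ^+ 2 * B k.
pose c2 k := 2 * (Cpall^-1 + c * L) ^+ 2 * B k / tau k.
pose c3 k := (c * L) ^+ 2 * mu k ^+ 2.
(* The factor [K] comes from [sqr_sum_le] and the factor 2 from splitting each summand in two. The
   first two rates already dominate the error, so the third constant is 0. *)
exists (2 * K%:R * \sum_k (c1 k + c3 k)), (2 * K%:R * \sum_k c2 k), 0.
move=> N1 N2 N10 N2N1.
(* Once the ratio is at least 1, [N2 n] cannot be 0. *)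
have [n0 N2pos] : exists n0, forall n, (n0 <= n)%N -> (0 < N2 n)%N.
  have /cvgryPge/(_ 1) [n0 _ H] := N2N1; exists n0 => n /H /=.
  by case: (N2 n) => //; rewrite mul0r ler10.
(* This exceeds the budget of every index below [n0], so a budget that reaches it forces
   [n0 <= n]. *)
exists (\sum_(i < n0) (K * N1 i + N2 i)).+1 => n Nn p p01 pC.
move=> d1 d2 O1 O2 P1 P2 Z1 Z2 _ [lawZ indepZ] w1 x1 ev.
have {Nn} N20 : (0 < N2 n)%N.
  apply: N2pos; rewrite leqNgt; apply/negP => nn0.
  move: Nn; rewrite (bigD1 (Ordinal nn0))//= ltnNge => /negP; apply.
  exact: leq_addr.
have N1R : 1 <= (N1 n)%:R :> R by rewrite ler1n.
have N2R : 0 < (N2 n)%:R :> R by rewrite ltr0n.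
have t0 : 0 < Num.sqrt (N1 n)%:R :> R by rewrite sqrtr_gt0; lra.
set N := stage2_size (N1 n) (N2 n) x1.
pose est k w := sample_mean (matching_values (fun j => Z2 k j w) (N k)).
pose wh := w_hat (N1 n) x1.
have mest k : measurable_fun setT (est k) by exact: measurable_sample_mean.
have [e eE eB] : exists2 e : 'I_K -> R,
    forall k, (\int[P2]_w ((est k w - mu k) ^+ 2)%:E = (e k)%:E)%E &
    forall k, e k <= B k /\ ((N k)%:R * p k) * e k <= B k.
  have H k : exists e : R,
      (\int[P2]_w ((est k w - mu k) ^+ 2)%:E = e%:E)%E /\
      (e <= B k /\ ((N k)%:R * p k) * e <= B k).
    have indepk := mutually_independent_stratum _ _ _ _ _ _ _ _ _ k indepZ.
    have [e] := @sample_mean_mse _ _ _ P2 (p k) (D k) (Z2 k) (p01 k) (lawZ k)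
      indepk (mu k) (a k) (s2 k) (posD k) (negD k) (s2E k) (N k).
    by exists e.
  by have [e He] := choice H; exists e => k; have [] := He k.
have e0 k : 0 <= e k.
  by rewrite -lee_fin -eE; apply: integral_ge0 => w _; rewrite lee_fin sqr_ge0.
(* The majorant separates the error of [est k] from that of the weight, so its integral involves
   only the mean squared errors [e k], with no covariance between strata. *)
pose f k w := 2 * K%:R * (wh k ^+ 2 * (est k w - mu k) ^+ 2 +
  (wh k - weight p k) ^+ 2 * mu k ^+ 2).
pose r k := 2 * K%:R * (wh k ^+ 2 * e k + (wh k - weight p k) ^+ 2 * mu k ^+ 2).
have sqr_est_ge0 k w : 0 <= wh k ^+ 2 * (est k w - mu k) ^+ 2.
  by rewrite mulr_ge0 ?sqr_ge0.
have bias_ge0 k : 0 <= (wh k - weight p k) ^+ 2 * mu k ^+ 2.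
  by rewrite mulr_ge0 ?sqr_ge0.
have f0 k w : 0 <= f k w by rewrite mulr_ge0// addr_ge0.
have merr k : measurable_fun setT (fun w => (est k w - mu k) ^+ 2).
  by apply: measurable_funX; exact: measurable_funB.
have mf k : measurable_fun setT (f k).
  apply: measurable_funM => //; apply: measurable_funD => //.
  exact: measurable_funM.
have fr k : (\int[P2]_w (f k w)%:E = (r k)%:E)%E.
  under eq_integral do rewrite EFinM.
  rewrite ge0_integralZl_EFin//; last 2 first.
  - by move=> w _; rewrite lee_fin addr_ge0.
  - apply/measurable_EFinP; apply: measurable_funD => //.
    exact: measurable_funM.
  under eq_integral do rewrite EFinD.
  rewrite ge0_integralD//; last 3 first.
  - by move=> w _; rewrite lee_fin.
  - by apply/measurable_EFinP; exact: measurable_funM.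
  - by move=> w _; rewrite lee_fin.
  under eq_integral do rewrite EFinM.
  rewrite ge0_integralZl_EFin ?sqr_ge0//; last 2 first.
  - by move=> w _; rewrite lee_fin sqr_ge0.
  - exact/measurable_EFinP.
  by rewrite integral_cst//= probability_setT mule1 eE /r !(EFinM, EFinD).
have dom w :
    (mu_hat_all (N1 n) (N2 n) x1 (fun k j => Z2 k j w) - mu_all p D) ^+ 2 <=
    \sum_k f k w.
  have -> : mu_hat_all (N1 n) (N2 n) x1 (fun k j => Z2 k j w) - mu_all p D =
      \sum_k (wh k * (est k w - mu k) + (wh k - weight p k) * mu k).
    rewrite /mu_hat_all /mu_all -sumrB; apply: eq_bigr => k _.
    by rewrite /wh /est /N /mu; ring.
  apply: (le_trans (sqr_sum_le _ _ _)); rewrite mulr_sumr.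
  apply: ler_sum => k _.
  pose y := wh k * (est k w - mu k); pose z := (wh k - weight p k) * mu k.
  have -> : f k w = K%:R * (2 * (y ^+ 2 + z ^+ 2)) by rewrite /f /y /z; ring.
  rewrite ler_wpM2l// -/y -/z.
  by have := sqr_ge0 (y - z); rewrite sqrrB sqrrD; lra.
have mse : ('E_P2[fun w =>
     ((mu_hat_all (N1 n) (N2 n) x1 (fun k j => Z2 k j w) - mu_all p D) ^+ 2)%R]
   <= (\sum_k r k)%:E)%E.
  rewrite -(@ge0_integral_sum_EFin _ _ _ P2 _ xpredT f)// unlock.
  apply: ge0_le_integral => //.
  - by move=> w _; rewrite lee_fin sqr_ge0.
  - apply/measurable_EFinP; apply: measurable_funX.
    apply: measurable_funB => //.
    apply: measurable_sum => k; apply: measurable_funM; last exact: mest.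
    exact: measurable_cst.
  - by apply/measurable_EFinP; exact: measurable_sum.
  - by move=> w _; rewrite lee_fin.
apply: (le_trans mse); rewrite lee_fin mul0r addr0.
rewrite [leRHS](_ : _ = 2 * K%:R *
    \sum_k ((c1 k + c3 k) / (N1 n)%:R + c2 k / (N2 n)%:R)); last first.
  by rewrite [in RHS]big_split/= -!mulr_suml; ring.
rewrite mulr_sumr.
apply: ler_sum => k _; rewrite /r ler_wpM2l//.
have /andP[pk0 pk1] := p01 k.
have sp0 := sqrtr_ge0 (p k).
have /andP[wlo whi] := ev_w_hat ev k.
rewrite -/wh -/L in wlo whi.
set dev := c * _ in wlo whi.
have dev0 : 0 <= dev.
  by rewrite /dev !mulr_ge0 ?invr_ge0 ?(ltW L0) ?(ltW t0).
have wk : weight p k <= p k / Cpall.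
  by rewrite /weight ler_wpM2l// lef_pV2 ?posrE//; exact: lt_le_trans pC.
have tauk : 0 < tau k.
  rewrite divr_gt0// (bigD1 k)//= ltr_pwDl// sumr_ge0// => i _; exact/ltW.
have A01 : 1 <= A0.
  have := sqr_ge0 c; have := sqrtr_ge0 L; rewrite /A0; nra.
have [ek1 ek2] := eB k.
have W := @weighted_mse_le R (p k) (wh k) (e k) (N k)%:R (B k) L c Cpall (tau k)
  A0 (N1 n)%:R (N2 n)%:R (p01 k) Cp0 (ltW L0) c0 tauk A01 N1R N2R (e0 k) ek1 ek2
  (w_hat_ge0 _ _ _ _ _).
(* Condition (ii) and [wk] give the bound on [wh k] that [weighted_mse_le] requires;
   [stage2_size_ge] gives the one on the sample size. *)
have {}W : wh k ^+ 2 * e k <= c1 k / (N1 n)%:R + c2 k / (N2 n)%:R.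
  apply: W; first by rewrite -/dev; lra.
  exact: stage2_size_ge.
(* By (ii) the weight deviates by at most [dev], whose square is [(c * L) ^+ 2 * p k / (N1 n)%:R],
   and [p k <= 1]. *)
have V : (wh k - weight p k) ^+ 2 * mu k ^+ 2 <= c3 k / (N1 n)%:R.
  rewrite /c3 [leRHS]mulrAC ler_wpM2r ?sqr_ge0//.
  have : (wh k - weight p k) ^+ 2 <= dev ^+ 2.
    have dl : - dev <= wh k - weight p k by lra.
    have du : wh k - weight p k <= dev by lra.
    nra.
  move=> /le_trans; apply.
  have -> : dev ^+ 2 =
      (c * L) ^+ 2 * (Num.sqrt (p k) ^+ 2 / Num.sqrt (N1 n)%:R ^+ 2).
    by rewrite -expr_div_n -exprMn /dev; congr (_ ^+ 2); ring.
  by rewrite !sqr_sqrtr// ler_wpM2l ?sqr_ge0// ler_piMl// invr_ge0.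
lra.
Qed.
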